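(* Let $1\le k\le N-1$, let $X=Gr(k,N)$, let $H\to X$ be the tautological bundle, and let $\gamma_0$ and $\gamma_1$ be the sections of $\mathrm{Hom}(H_\zeta,H_z)$ and $\mathrm{Hom}(H_\zeta,H_z)\otimes E^*\wedge T^*_{0,1}(X\times X)$ over $X\times X$ defined in the context. Then the section $G:=\gamma_0+\gamma_1\in\mathcal{L}^0_H$ is a weight for the tautological bundle $H$; that is, $\gamma_0(z,z)=\mathrm{Id}$ for all $z\in X$ and $\nabla_\eta G=0$.
   Context: $H\to X$ is the tautological rank-$k$ subbundle of the trivial bundle $X\times\mathbb{C}^N$ with the metric induced from the standard Hermitian metric on $\mathbb{C}^N$; $F=\mathbb{C}^N/H$ is the quotient bundle. $\pi_{H_z}$ denotes orthogonal projection $\mathbb{C}^N\to H_z$ (extended to $\mathbb{C}^N$-valued forms by acting on the $\mathbb{C}^N$-factor), and $\varphi:F\to H^\perp\subset\mathbb{C}^N$ is the smooth bundle isomorphism $\varphi(v+H_z)=v-\pi_{H_z}v$. On $X\times X=X_z\times X_\zeta$, subscripts $z,\zeta$ denote pull-backs under the two projections. $E=F_z\otimes H_\zeta^*\cong\mathrm{Hom}(H_\zeta,F_z)$ is a holomorphic bundle of rank $n=k(N-k)$ on $X\times X$. Its section $\eta$ is given by: $\eta(v)$, for $v\in H_\zeta\subset\mathbb{C}^N$, is the class of $v$ in $\mathbb{C}^N/H_z=F_z$. $\mathcal{L}^m_H=\bigoplus_p\Gamma\big(X\times X,\mathrm{Hom}(H_\zeta,H_z)\otimes[\Lambda^pE^*\wedge\Lambda^{p+m}T^*_{0,1}(X\times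 X)]\big)$ (smooth sections; $E^*$ and $T^*$ are generated inside one exterior algebra $\Lambda[T^*(X\times X)\oplus E\oplus E^*]$). $\delta_\eta$ is contraction with $\eta$ on $E^*$ (an antiderivation on the exterior algebra, acting as the identity on the factor $\mathrm{Hom}(H_\zeta,H_z)$), and $\nabla_\eta=\delta_\eta-\bar\partial:\mathcal{L}^m_H\to\mathcal{L}^{m+1}_H$. A weight for a bundle $H$ is a section $g\in\mathcal{L}^0_H$ with $\nabla_\eta g=0$ whose component $g_{0,0}$ of degree $0$ in both $E^*$ and $T^*_{0,1}$ satisfies $g_{0,0}(z,z)=\mathrm{Id}$ for all $z$. $\gamma_0$: for $v\in H_\zeta\subset\mathbb{C}^N$, $\gamma_0(v)=\pi_{H_z}v$. $\gamma_1$: for germs of smooth sections $\xi$ of $E$ and $v$ of $H_\zeta$, $\xi(v)$ is a smooth section of $F_z$, $\varphi(\xi(v))$ is a smooth section of $H_z^\perp\subset\mathbb{C}^N$, and $\gamma_1(\xi\otimes v)=-\pi_{H_z}\big(\bar\partial\,\varphi(\xi(v))\big)$, a smooth section of $H_z\otimes T^*_{0,1}(X\times X)$. This expression is linear over smooth functions in $\xi$ and $v$, and so defines a section $\gamma_1$ of $\mathrm{Hom}(H_\zeta,H_z)\otimes E^*\wedge T^*_{0,1}(X\times X)$; the identification is such that $(\delta_\eta\gamma_1)(v)=\gamma_1(\eta\otimes v)$, i.e. in a local frame $(e_i)$ of $E$ with dual frame $(e_i^* )$, $\gamma_1$ corresponds to $\sum_i e_i^*\wedge\gamma_1(e_i\otimes\cdot)$.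 *)

(* Defs.v *)
From HB Require Import structures.
From mathcomp Require Import all_boot all_order all_algebra.
From mathcomp Require Import sesquilinear spectral complex.
From mathcomp Require Import boolp classical_sets reals topology normedtype.
From mathcomp Require Import derive.

(* R[i], for R : realType, is the field of complex numbers.
   Vectors of C^N are row vectors and linear maps act on the right.  Sections
   of bundles over X * X are given by their components in the affine charts of
   X * X and the associated holomorphic frames, and are required to transform
   correctly under a change of chart. *)

Set Implicit Arguments.
Unset Strict Implicit.
Unset Printing Implicit Defensive.

Import Order.TTheory GRing.Theory Num.Theory.
Import numFieldNormedType.Exports.
Local Open Scope ring_scope.
Local Open Scope complex_scope.

Section Calculus.
Context {R : realType}.
Local Notation C := R[i].

Fixpoint continuously_derivable (n : nat) (V : normedModType R) (f : V -> R)
    : Prop :=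
  continuous f /\
  if n is n'.+1 then
    forall v : V, (forall p, derivable f p v) /\
                  continuously_derivable n' (fun p => 'D_v f p)
  else True.

Definition smooth (V : normedModType R) (f : V -> C) : Prop :=
  forall n, continuously_derivable n (fun p => complex.Re (f p)) /\
            continuously_derivable n (fun p => complex.Im (f p)).

Definition Cderive (V : normedModType R) (v : V) (f : V -> C) (p : V) : C :=
  ('D_v (fun q => complex.Re (f q)) p)
  +i* ('D_v (fun q => complex.Im (f q)) p).

End Calculus.

Section Grassmannian.
Context {R : realType} {N k : nat}.
Local Notation C := R[i].
Local Notation m := (N - k)%N.

(* A subspace of C^N is represented by the canonical matrix [<<V>>] having it
   as row space, so that equality in [Gr] is equality of subspaces; the fibre
   H_z is the row space of [val z]. *)
Definition Gr : Type := {V : 'M[C]_N | (<<V>>%MS == V) && (\rank V == k)}.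

(* A basis of C^N split in two; the chart sends Z : 'M_(k, m) to the subspace
   spanned by the rows of chA + Z chB.  These rows are a holomorphic frame of
   H, and the classes modulo H_z of the rows of chB are a holomorphic frame
   of F. *)
Record chart : Type := Chart {
  chA : 'M[C]_(k, N);
  chB : 'M[C]_(m, N);
  chart_free : row_free (col_mx chA chB)
}.

Definition frame (c : chart) (Z : 'M[C]_(k, m)) : 'M[C]_(k, N) :=
  chA c + Z *m chB c.

Lemma frame_free c Z : row_free (frame c Z).
Proof.
have -> : frame c Z = row_mx 1%:M Z *m col_mx (chA c) (chB c).
  by rewrite mul_row_col mul1mx.
rewrite /row_free mxrankMfree ?chart_free //; apply/row_freeP.
by exists (col_mx 1%:M 0); rewrite mul_row_col mulmx0 mulmx1 addr0.
Qed.

Fact pt_subproof c Z :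
  (<< <<frame c Z>> >>%MS == <<frame c Z>>%MS) && (\rank <<frame c Z>> == k).
Proof. by rewrite genmx_id eqxx genmxE; exact: frame_free. Qed.

Definition pt (c : chart) (Z : 'M[C]_(k, m)) : Gr :=
  exist _ <<frame c Z>>%MS (pt_subproof c Z).

(* Inverse of [pt c]: the span of the rows of h = U chA + V chB, with U
   invertible, is also the span of the rows of chA + (U^-1 V) chB. *)
Definition coord (c : chart) (h : 'M[C]_(k, N)) : 'M[C]_(k, m) :=
  let UV := h *m pinvmx (col_mx (chA c) (chB c)) in
  invmx (lsubmx UV) *m rsubmx UV.

Lemma pt_coord c Z (h : 'M[C]_(k, N)) :
  (h == frame c Z)%MS -> coord c h = Z.
Proof.
case/andP => /submxP[P hP] /submxP[Q fQ].
have PU : P \in unitmx.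
  have /mulmx1_unit[] // : P *m Q = 1%:M.
  apply: mulmx1C; apply: (row_free_inj (frame_free c Z)).
  by rewrite -mulmxA -hP -fQ mul1mx.
rewrite /coord; have -> : h = row_mx P (P *m Z) *m col_mx (chA c) (chB c).
  by rewrite hP mul_row_col mulmxDr mulmxA.
by rewrite -mulmxA mulmxVp ?chart_free // mulmx1 row_mxKl row_mxKr mulKmx.
Qed.

Lemma charts_cover : (k <= N)%N -> forall z : Gr, exists c, pt c 0 = z.
Proof.
move=> kN [V pV]; have /andP[/eqP VV /eqP rV] := pV.
have rW : \rank (complmx V) = m by rewrite mxrank_compl rV.
have [A AE] : exists A : 'M[C]_(k, N), (A :=: V)%MS.
  by case: _ / rV; exists (row_base V); exact: eq_row_base.
have [B BE] : exists B : 'M[C]_(m, N), (B :=: complmx V)%MS.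
  by case: _ / rW; exists (row_base (complmx V)); exact: eq_row_base.
have fr : row_free (col_mx A B).
  rewrite /row_free -addsmxE (adds_eqmx AE BE).
  by rewrite (eqP (addsmx_compl_full V)) subnKC.
exists (Chart fr); apply: val_inj => /=.
by rewrite /frame mul0mx addr0 -[RHS]VV; exact: eq_genmx.
Qed.

(* Coordinates of the rows of v in the frame [frame c Z] of H_z. *)
Definition Hcoord (r : nat) (c : chart) (Z : 'M[C]_(k, m)) (v : 'M[C]_(r, N)) :
    'M[C]_(r, k) :=
  v *m pinvmx (frame c Z).

(* Coordinates of the classes v + H_z, v a row of the argument, in the frame of
   F_z = C^N / H_z made of the classes of the rows of chB. *)
Definition Fcoord (r : nat) (c : chart) (Z : 'M[C]_(k, m)) (v : 'M[C]_(r, N)) :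
    'M[C]_(r, m) :=
  rsubmx (v *m pinvmx (col_mx (frame c Z) (chB c))).

Definition piH (z : Gr) : 'M[C]_N := proj_ortho (val z).

(* phi (v + H_z), which does not depend on the representative v. *)
Definition phi (z : Gr) (v : 'rV[C]_N) : 'rV[C]_N := v - v *m piH z.

(* Real coordinates (Re z, Im z, Re zeta, Im zeta) on a chart of X * X. *)
Definition cspace : Type := ('M[R]_(k, m) * 'M[R]_(k, m))%type.
Definition cspace2 : normedModType R :=
  (('M[R]_(k, m) * 'M[R]_(k, m)) * ('M[R]_(k, m) * 'M[R]_(k, m)))%type.

Definition cmx (x : cspace) : 'M[C]_(k, m) :=
  \matrix_(i, j) (x.1 i j +i* x.2 i j).

Definition zco (p : cspace2) : 'M[C]_(k, m) := cmx p.1.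
Definition wco (p : cspace2) : 'M[C]_(k, m) := cmx p.2.

(* Index of a complex coordinate: [(false, (i, j))] is z_ij and
   [(true, (i, j))] is zeta_ij. *)
Definition tidx : finType := (bool * ('I_k * 'I_m))%type.

Definition coordinate (t : tidx) (Z W : 'M[C]_(k, m)) : C :=
  (if t.1 then W else Z) t.2.1 t.2.2.

Definition dx (t : tidx) : cspace2 :=
  let e := delta_mx t.2.1 t.2.2 in if t.1 then (0, (e, 0)) else ((e, 0), 0).
Definition dy (t : tidx) : cspace2 :=
  let e := delta_mx t.2.1 t.2.2 in if t.1 then (0, (0, e)) else ((0, e), 0).

(* The Wirtinger derivative with respect to the conjugate of the t-th complex
   coordinate. *)
Definition dzbar (t : tidx) (f : cspace2 -> C) (p : cspace2) : C :=
  (Cderive (dx t) f p + (0 +i* 1) * Cderive (dy t) f p) / 2.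

Definition dzbarmx (r s : nat) (t : tidx) (F : cspace2 -> 'M[C]_(r, s))
    (p : cspace2) : 'M[C]_(r, s) :=
  \matrix_(i, j) dzbar t (fun q => F q i j) p.

(* The frame (e_(a, b)) of E = Hom(H_zeta, F_z): e_(a, b) maps the a-th vector
   of the frame of H_zeta to the b-th vector of the frame of F_z and the other
   ones to 0. *)
Definition eidx : finType := ('I_k * 'I_m)%type.

(* A form of degree r is an alternating r-linear function on T_{0,1} + E; it is
   given by its values on the holomorphic frame made of the d/d(zbar_t), indexed
   by [inl t], and of the e_(a, b), indexed by [inr (a, b)]. *)
Definition gen : finType := (tidx + eidx)%type.

(* Components of an inhomogeneous form with values in Hom(H_zeta, H_z), in the
   chart c (for z) and c' (for zeta): the matrix [s c c' l p] represents the
   value of the form at p on the frame vectors listed in l, from the frame of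
   H_zeta to that of H_z. *)
Definition components : Type :=
  chart -> chart -> seq gen -> cspace2 -> 'M[C]_k.

Definition same_point (c c' d d' : chart) (p q : cspace2) : Prop :=
  pt c (zco p) = pt d (zco q) /\ pt c' (wco p) = pt d' (wco q).

(* Coefficient on the frame vector x for (c, c') of the frame vector y for
   (d, d'), at the point with coordinates p in (c, c') and q in (d, d'). *)
Definition change (c c' d d' : chart) (p q : cspace2) (x y : gen) : C :=
  match x, y with
  | inl t, inl u =>
      dzbar u (fun q' => (coordinate t (coord c (frame d (zco q')))
                                       (coord c' (frame d' (wco q'))))^*) q
  | inr a, inr b =>
      Hcoord d' (wco q) (frame c' (wco p)) a.1 b.1 *
      Fcoord c (zco p) (chB d) b.2 a.2
  | _, _ => 0
  end.

Definition compatible (s : components) : Prop :=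
  forall c c' d d' p q, same_point c c' d d' p q -> forall l : seq gen,
    s d d' l q *m Hcoord c (zco p) (frame d (zco q)) =
    Hcoord c' (wco p) (frame d' (wco q)) *m
      \sum_(l' : (size l).-tuple gen)
        (\prod_(xy <- zip l' l) change c c' d d' p q xy.1 xy.2) *: s c c' l' p.

Definition alternating (s : components) : Prop :=
  forall c c' l1 x y l2 p,
    s c c' (l1 ++ [:: x, y & l2]) p = - s c c' (l1 ++ [:: y, x & l2]) p.

Definition is_T (x : gen) : bool := if x is inl _ then true else false.

Definition bidegree_diff (d : int) (s : components) : Prop :=
  forall c c' l p, s c c' l p != 0 ->
    (count is_T l)%:Z = (count (predC is_T) l)%:Z + d.

(* The space L^d_H, the sum over p of the smooth sections of bidegree p in E^*
   and p + d in T^*_{0,1}. *)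
Definition in_L (d : int) (s : components) : Prop :=
  [/\ forall c c' l i j, smooth (fun p => s c c' l p i j),
      alternating s, bidegree_diff d s & compatible s].

(* eta maps v in H_zeta to v + H_z. *)
Definition eta (c c' : chart) (p : cspace2) (e : eidx) : C :=
  Fcoord c (zco p) (frame c' (wco p)) e.1 e.2.

(* Contraction with eta, as first argument. *)
Definition delta_eta (s : components) : components := fun c c' l p =>
  \sum_(e : eidx) eta c c' p e *: s c c' (inr e :: l) p.

(* As the frames are holomorphic, dbar is the sum over t of d(zbar_t) wedge the
   derivative of the components, evaluated here on the vectors listed in l. *)
Definition dbar (s : components) : components := fun c c' l p =>
  \sum_(r < size l) (-1) ^+ r *:
    if onth l r is Some (inl t)
    then dzbarmx t (s c c' (take r l ++ drop r.+1 l)) p else 0.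

Definition nabla_eta (s : components) : components := fun c c' l p =>
  delta_eta s c c' l p - dbar s c c' l p.

Definition is_weight (g : components) : Prop :=
  [/\ in_L 0 g,
      forall c c' l p, nabla_eta g c c' l p = 0 &
      forall c c' p, pt c (zco p) = pt c' (wco p) ->
        g c c' [::] p *m frame c (zco p) = frame c' (wco p)].

Definition gamma0 : components := fun c c' l p =>
  if l is [::] then
    Hcoord c (zco p) (frame c' (wco p) *m piH (pt c (zco p)))
  else 0.

(* The d(zbar_t)-component of - pi_(H_z) (dbar (phi (xi v))), where xi is the
   section of E with matrix [xi] in the frame (e_(a, b)) and v the section of
   H_zeta with coordinates [v], so that v *m xi *m chB c represents xi v. *)
Definition gamma1_at (c c' : chart) (xi : cspace2 -> 'M[C]_(k, m))
    (v : cspace2 -> 'rV[C]_k) (t : tidx) (p : cspace2) : 'rV[C]_N :=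
  - (dzbarmx t (fun q => phi (pt c (zco q)) (v q *m xi q *m chB c)) p
     *m piH (pt c (zco p))).

(* gamma_1 (e_(a, b) (x) _) on d/d(zbar_t), as a matrix between frames. *)
Definition gamma1_mx (c c' : chart) (e : eidx) (t : tidx) (p : cspace2) :
    'M[C]_k :=
  \matrix_i Hcoord c (zco p)
    (gamma1_at c c' (fun=> delta_mx e.1 e.2) (fun=> delta_mx 0 i) t p).

(* The sum over e of e^* wedge gamma_1 (e (x) _), where
   (f wedge g) (u, v) = f u * g v - f v * g u for forms of degree 1. *)
Definition gamma1 : components := fun c c' l p =>
  match l with
  | [:: inr e; inl t] => gamma1_mx c c' e t p
  | [:: inl t; inr e] => - gamma1_mx c c' e t p
  | _ => 0
  end.

Definition add_components (s1 s2 : components) : components := fun c c' l p =>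
  s1 c c' l p + s2 c c' l p.

End Grassmannian.

(* Main.v *)
Require Import Defs.
From mathcomp Require Import all_boot all_order all_algebra.
From mathcomp Require Import reals.
From HB Require Import structures.
From mathcomp Require Import sesquilinear spectral complex.
From mathcomp Require Import boolp classical_sets topology normedtype.
From mathcomp Require Import derive ring.

(**
Let A be the holomorphic frame of H_z given by a chart, as a k x N matrix, and B
the one of H_zeta.  The orthogonal projection on H_z is P A, where
P = A^* (A A^* )^-1 is the right inverse of A.  Hence, in the frames, gamma_0 is
the matrix B P.  As A is holomorphic and A P = 1,

  dbar (P A) . P A = dbar P . A P A = dbar P . A,

so gamma_1 (e_(a, b), _) is delta_ab chB (dbar P) (lemmas [gamma0E] and
[gamma1_mxE]).  Differentiating the formula for P gives

  dbar_t P = (1 - P A) E_t (A A^* )^-1,   E_t := dbar_t A^* constant,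

which is the function [drinv] below; in particular A (dbar_t P) = 0.

The equation nabla_eta G = 0 has two components that are not zero for reasons of
degree.
- delta_eta gamma_1 = dbar gamma_0 [sum_eta_gamma1, dzbarmx_gamma0].  Let Q be
  the matrix of eta, so that B = S A + Q chB for some S.  The left-hand side is
  Q chB (dbar P) and the right-hand side is B (dbar P), because B is
  holomorphic; they agree because A (dbar P) = 0.
- dbar gamma_1 = 0 [dzbarmx_gamma1C].  The formula for dbar_t P yields an
  expression of dbar_t dbar_u P which is symmetric in t and u.

On the diagonal B and A span the same space, so B P A = B.

The remaining part is that the components transform as a section under a change
of charts from (c, c') to (d, d').  Write A_d = T A_c with T invertible; then
P_d = P_c T^-1, which settles gamma_0.  For gamma_1 one needs the chain rule for
the conjugate of the transition map tau, and it is enough to have it modulo the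
row space of A, because dbar P has the factor 1 - P A; this is the identity

  (1 - P A) (chB_c)^* (dbar_u tau^* ) T^* = (1 - P A) dbar_u A_d^*

of [transition_derivative], obtained by differentiating
A_d = U (chA_c + tau chB_c), where U = T at the point considered.
*)

Set Implicit Arguments.
Unset Strict Implicit.
Unset Printing Implicit Defensive.

Import Order.TTheory GRing.Theory Num.Theory.
Import numFieldNormedType.Exports.
Local Open Scope classical_set_scope.
Local Open Scope ring_scope.
Local Open Scope complex_scope.
Local Open Scope sesquilinear_scope.

(** * Calculus of real-valued functions *)

Section RealCalculus.
Context {R : realType} {V : normedModType R}.
Implicit Types f g : V -> R.

(** The next six lemmas are stated for eta-expanded functions, the form that
    rewriting under binders produces. *)
Lemma derivable_add f g p v : derivable f p v -> derivable g p v ->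
  derivable (fun q => f q + g q) p v.
Proof. exact: derivableD. Qed.

Lemma derivable_mul f g p v : derivable f p v -> derivable g p v ->
  derivable (fun q => f q * g q) p v.
Proof. exact: derivableM. Qed.

Lemma derive_add f g p v : derivable f p v -> derivable g p v ->
  'D_v (fun q => f q + g q) p = 'D_v f p + 'D_v g p.
Proof. exact: deriveD. Qed.

Lemma derive_mul f g p v : derivable f p v -> derivable g p v ->
  'D_v (fun q => f q * g q) p = 'D_v f p * g p + f p * 'D_v g p.
Proof.
move=> df dg; rewrite [LHS](deriveM df dg) addrC; congr (_ + _).
exact: mulrC.
Qed.

Lemma derivable_oppf f p v : derivable f p v -> derivable (fun q => - f q) p v.
Proof. exact: derivableN. Qed.

Lemma derive_oppf f p v : derivable f p v ->
  'D_v (fun q => - f q) p = - 'D_v f p.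
Proof. exact: deriveN. Qed.

(** In the names of lemmas, cd stands for [continuously_derivable]. *)
Lemma cd_continuous n f : continuously_derivable n f -> continuous f.
Proof. by case: n => [|n] []. Qed.

Lemma cd_derivable n f p v : continuously_derivable n.+1 f -> derivable f p v.
Proof. by case=> _ /(_ v)[]. Qed.

Lemma cdW n f : continuously_derivable n.+1 f -> continuously_derivable n f.
Proof.
elim: n f => [|n IHn] f; first by move/cd_continuous.
by case=> cf df; split=> // v; have [dfv /IHn] := df v.
Qed.

Lemma cd_cst n (a : R) : continuously_derivable n (fun _ : V => a).
Proof.
elim: n a => [|n IHn] a; have ca : continuous (fun _ : V => a)
  by move=> p; exact: cvg_cst.
  by split.
split=> // v; split=> [p|]; first exact: derivable_cst.
rewrite [X in continuously_derivable n X](_ : _ = fun=> 0) //.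
by apply/funext => p; rewrite derive_cst.
Qed.

Lemma cdD n f g : continuously_derivable n f -> continuously_derivable n g ->
  continuously_derivable n (fun p => f p + g p).
Proof.
elim: n f g => [|n IHn] f g cf cg; have cfg : continuous (fun p => f p + g p)
  by move=> p; apply: cvgD; [exact: (cd_continuous cf)
                             |exact: (cd_continuous cg)].
  by split.
split=> // v; split=> [p|].
  by apply: derivableD; [exact: cd_derivable cf|exact: cd_derivable cg].
rewrite [X in continuously_derivable n X](_ : _ = fun p => 'D_v f p + 'D_v g p).
  by apply: IHn; [case: cf => _ /(_ v)[]|case: cg => _ /(_ v)[]].
apply/funext => p.
by apply: deriveD; [exact: cd_derivable cf|exact: cd_derivable cg].
Qed.

Lemma cdN n f : continuously_derivable n f ->
  continuously_derivable n (fun p => - f p).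
Proof.
elim: n f => [|n IHn] f cf; have cNf : continuous (fun p => - f p)
  by move=> p; apply: cvgN; exact: (cd_continuous cf).
  by split.
split=> // v; split=> [p|]; first by apply: derivable_oppf; exact: cd_derivable cf.
rewrite [X in continuously_derivable n X](_ : _ = fun p => - 'D_v f p).
  by apply: IHn; case: cf => _ /(_ v)[].
by apply/funext => p; apply: derive_oppf; exact: cd_derivable cf.
Qed.

Lemma cdM n f g : continuously_derivable n f -> continuously_derivable n g ->
  continuously_derivable n (fun p => f p * g p).
Proof.
elim: n f g => [|n IHn] f g cf cg; have cfg : continuous (fun p => f p * g p)
  by move=> p; apply: cvgM; [exact: (cd_continuous cf)
                             |exact: (cd_continuous cg)].
  by split.
split=> // v; split=> [p|].
  by apply: derivableM; [exact: cd_derivable cf|exact: cd_derivable cg].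
rewrite [X in continuously_derivable n X](_ : _ =
    fun p => f p * 'D_v g p + g p * 'D_v f p).
  apply: cdD; apply: IHn; try exact: cdW.
    by case: cg => _ /(_ v)[].
  by case: cf => _ /(_ v)[].
apply/funext => p.
by apply: deriveM; [exact: cd_derivable cf|exact: cd_derivable cg].
Qed.

(** The derivative of 1/f involves 1/f itself, but at the lower order of
    differentiability, hence the induction on n. *)
Lemma cdV n f : (forall p, f p != 0) -> continuously_derivable n f ->
  continuously_derivable n (fun p => (f p)^-1).
Proof.
move=> f0; elim: n => [|n IHn] cf; have cVf : continuous (fun p => (f p)^-1)
  by move=> p; apply: cvgV => //; exact: (cd_continuous cf).
  by split.
split=> // v; split=> [p|].
  by apply: derivableV => //; exact: cd_derivable cf.
rewrite [X in continuously_derivable n X](_ : _ =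
    fun p => - ((f p)^-1 * (f p)^-1) * 'D_v f p).
  apply: cdM; last by case: cf => _ /(_ v)[].
  by apply: cdN; apply: cdM; apply: IHn; exact: cdW.
apply/funext => p; rewrite deriveV //; last exact: cd_derivable cf.
by rewrite -invfM -expr2.
Qed.

(** The difference quotient of a linear function is constant. *)
Lemma linear_derive f p v : (forall h p v, f (h *: v + p) = h * f v + f p) ->
  derivable f p v /\ 'D_v f p = f v.
Proof.
move=> lf.
have cvgf : (fun h => h^-1 *: ((f \o shift p) (h *: v) - f p)) @ 0^' --> f v.
  apply: (@cvg_trans _ ((fun=> f v) @ (0 : R)^')); last exact: cvg_cst.
  apply: near_eq_cvg; near=> h.
  have h0 : h != 0 by near: h; exact: nbhs_dnbhs_neq.
  by rewrite /= lf addrK -[h * _]/(h *: _) scalerA mulVf // scale1r.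
by split; [apply/cvg_ex; exists (f v)|exact: cvg_lim cvgf].
Unshelve. all: by end_near.
Qed.

Lemma derive_linear f p v : (forall h p v, f (h *: v + p) = h * f v + f p) ->
  'D_v f p = f v.
Proof. by move=> lf; have [] := linear_derive p v lf. Qed.

Lemma cd_linear n f : continuous f ->
  (forall h p v, f (h *: v + p) = h * f v + f p) -> continuously_derivable n f.
Proof.
move=> cf lf; case: n => [|n]; split=> // v; split=> [p|].
  by have [] := linear_derive p v lf.
rewrite [X in continuously_derivable n X](_ : _ = fun=> f v).
  exact: cd_cst.
by apply/funext => p; have [] := linear_derive p v lf.
Qed.

End RealCalculus.

(** * Calculus of complex-valued functions *)

Section ComplexCalculus.
Context {R : realType} {V : normedModType R}.
Local Notation C := R[i].
Implicit Types f g : V -> C.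

Lemma Re_add (x y : C) : complex.Re (x + y) = complex.Re x + complex.Re y.
Proof. by case: x; case: y. Qed.
Lemma Im_add (x y : C) : complex.Im (x + y) = complex.Im x + complex.Im y.
Proof. by case: x; case: y. Qed.
Lemma Re_mul (x y : C) : complex.Re (x * y) =
  complex.Re x * complex.Re y - complex.Im x * complex.Im y.
Proof. by case: x; case: y. Qed.
Lemma Im_mul (x y : C) : complex.Im (x * y) =
  complex.Re x * complex.Im y + complex.Im x * complex.Re y.
Proof. by case: x; case: y. Qed.

Definition sqnorm (x : C) : R :=
  complex.Re x * complex.Re x + complex.Im x * complex.Im x.

Lemma sqnorm_eq0 x : (sqnorm x == 0) = (x == 0).
Proof.
by rewrite eq_complex /= paddr_eq0 -?expr2 ?sqr_ge0 // !expf_eq0.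
Qed.

Lemma Re_inv (x : C) : complex.Re x^-1 = complex.Re x * (sqnorm x)^-1.
Proof. by case: x => a b /=; rewrite /sqnorm /= -!expr2. Qed.
Lemma Im_inv (x : C) : complex.Im x^-1 = - (complex.Im x * (sqnorm x)^-1).
Proof. by case: x => a b /=; rewrite /sqnorm /= -!expr2. Qed.

Lemma smooth_cst (a : C) : smooth (fun _ : V => a).
Proof. by move=> n; split; exact: cd_cst. Qed.

Lemma smoothD f g : smooth f -> smooth g -> smooth (fun p => f p + g p).
Proof.
move=> sf sg n; have [rf jf] := sf n; have [rg jg] := sg n; split.
  by under eq_fun do rewrite Re_add; exact: cdD.
by under eq_fun do rewrite Im_add; exact: cdD.
Qed.

Lemma smoothM f g : smooth f -> smooth g -> smooth (fun p => f p * g p).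
Proof.
move=> sf sg n; have [rf jf] := sf n; have [rg jg] := sg n; split.
  under eq_fun do rewrite Re_mul.
  by apply: cdD; [|apply: cdN]; exact: cdM.
by under eq_fun do rewrite Im_mul; apply: cdD; exact: cdM.
Qed.

Lemma smooth_conj f : smooth f -> smooth (fun p => (f p)^*).
Proof.
move=> sf n; have [rf jf] := sf n; split.
  rewrite [X in continuously_derivable n X](_ : _ = fun p => complex.Re (f p)) //.
  by apply/funext => p; case: (f p).
rewrite [X in continuously_derivable n X](_ : _ = fun p => - complex.Im (f p)).
  exact: cdN.
by apply/funext => p; case: (f p).
Qed.

Lemma smoothV f : (forall p, f p != 0) -> smooth f -> smooth (fun p => (f p)^-1).
Proof.
move=> f0 sf n; have [rf jf] := sf n.
have ni : continuously_derivable n (fun p => (sqnorm (f p))^-1).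
  by apply: cdV => [p|]; [rewrite sqnorm_eq0|apply: cdD; exact: cdM].
split; first by under eq_fun do rewrite Re_inv; exact: cdM.
by under eq_fun do rewrite Im_inv; apply: cdN; exact: cdM.
Qed.

Lemma smooth_sum (I : Type) (r : seq I) (P : pred I) (F : I -> V -> C) :
  (forall i, smooth (F i)) -> smooth (fun p => \sum_(i <- r | P i) F i p).
Proof.
move=> sF; elim: r => [|i r IHr].
  by under eq_fun do rewrite big_nil; exact: smooth_cst.
under eq_fun do rewrite big_cons; case: (P i) => //.
exact: smoothD.
Qed.

Lemma smooth_prod (I : Type) (r : seq I) (P : pred I) (F : I -> V -> C) :
  (forall i, smooth (F i)) -> smooth (fun p => \prod_(i <- r | P i) F i p).
Proof.
move=> sF; elim: r => [|i r IHr].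
  by under eq_fun do rewrite big_nil; exact: smooth_cst.
under eq_fun do rewrite big_cons; case: (P i) => //.
exact: smoothM.
Qed.

Lemma smooth_near_neq0 f p : smooth f -> f p != 0 -> \forall q \near p, f q != 0.
Proof.
move=> sf fp; have [rf jf] := sf 0%N.
have cn : continuous (fun q => sqnorm (f q)).
  by apply: (@cd_continuous _ _ 0%N); apply: cdD; exact: cdM.
have n0 : sqnorm (f p) != 0 by rewrite sqnorm_eq0.
by apply: filterS (cvgr_neq0 _ (cn p) n0) => q; rewrite sqnorm_eq0.
Qed.

Definition Cderivable (p v : V) f : Prop :=
  derivable (fun q => complex.Re (f q)) p v /\
  derivable (fun q => complex.Im (f q)) p v.

Lemma smooth_Cderivable p v f : smooth f -> Cderivable p v f.
Proof.
by move=> /(_ 1%N)[rf jf]; split; [exact: cd_derivable rf|exact: cd_derivable jf].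
Qed.

Lemma smooth_Cderive v f : smooth f -> smooth (Cderive v f).
Proof.
by move=> sf n; have [[_ /(_ v)[_ ?]] [_ /(_ v)[_ ?]]] := sf n.+1; split.
Qed.

Lemma CderivableM p v f g : Cderivable p v f -> Cderivable p v g ->
  Cderivable p v (fun q => f q * g q).
Proof.
move=> [rf jf] [rg jg]; split.
  under eq_fun do rewrite Re_mul.
  by apply: derivable_add; [|apply: derivable_oppf]; exact: derivable_mul.
by under eq_fun do rewrite Im_mul; apply: derivable_add; exact: derivable_mul.
Qed.

Lemma CderivableV p v f : f p != 0 -> Cderivable p v f ->
  Cderivable p v (fun q => (f q)^-1).
Proof.
move=> f0 [rf jf].
have ni : derivable (fun q => (sqnorm (f q))^-1) p v.
  apply: derivableV; first by rewrite sqnorm_eq0.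
  by apply: derivable_add; exact: derivable_mul.
split; first by under eq_fun do rewrite Re_inv; exact: derivable_mul.
by under eq_fun do rewrite Im_inv; apply: derivable_oppf; exact: derivable_mul.
Qed.

Lemma near_Cderivable p v f g : {near p, f =1 g} ->
  Cderivable p v f -> Cderivable p v g.
Proof.
by move=> fg [rf jf]; split;
  [apply: near_eq_derivable rf|apply: near_eq_derivable jf];
  apply: filterS fg => q /= ->.
Qed.

Lemma near_Cderive p v f g : {near p, f =1 g} -> Cderive v f p = Cderive v g p.
Proof.
by move=> fg; congr (_ +i* _); apply: near_eq_derive; apply: filterS fg => q ->.
Qed.

Lemma CderiveD p v f g : Cderivable p v f -> Cderivable p v g ->
  Cderive v (fun q => f q + g q) p = Cderive v f p + Cderive v g p.
Proof.
move=> [rf jf] [rg jg]; congr (_ +i* _).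
  by under eq_fun do rewrite Re_add; exact: derive_add.
by under eq_fun do rewrite Im_add; exact: derive_add.
Qed.

Lemma CderiveM p v f g : Cderivable p v f -> Cderivable p v g ->
  Cderive v (fun q => f q * g q) p = Cderive v f p * g p + f p * Cderive v g p.
Proof.
move=> [rf jf] [rg jg].
rewrite /Cderive.
under eq_fun do rewrite Re_mul.
under [X in _ +i* 'D_v X _]eq_fun do rewrite Im_mul.
have rr := derivable_mul rf rg; have jj := derivable_mul jf jg.
have rj := derivable_mul rf jg; have jr := derivable_mul jf rg.
rewrite (derive_add rr (derivable_oppf jj)) (derive_oppf jj) (derive_add rj jr).
rewrite (derive_mul rf rg) (derive_mul jf jg).
rewrite (derive_mul rf jg) (derive_mul jf rg).
case: (f p) => a b; case: (g p) => c d; apply/eqP.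
by rewrite eq_complex /=; apply/andP; split; apply/eqP; ring.
Qed.

End ComplexCalculus.

(** * Calculus of matrix-valued functions *)

Section MatrixCalculus.
Context {R : realType} {V : normedModType R}.
Local Notation C := R[i].

Definition mxsmooth r s (F : V -> 'M[C]_(r, s)) : Prop :=
  forall i j, smooth (fun q => F q i j).

Definition mxderivable p r s (F : V -> 'M[C]_(r, s)) : Prop :=
  forall v i j, Cderivable p v (fun q => F q i j).

Lemma mxsmooth_derivable p r s (F : V -> 'M[C]_(r, s)) :
  mxsmooth F -> mxderivable p F.
Proof. by move=> sF v i j; exact: smooth_Cderivable. Qed.

Lemma mxsmooth_cst r s (A : 'M[C]_(r, s)) : mxsmooth (fun=> A).
Proof. by move=> i j; exact: smooth_cst. Qed.

Lemma mxsmoothD r s (F G : V -> 'M[C]_(r, s)) :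
  mxsmooth F -> mxsmooth G -> mxsmooth (fun q => F q + G q).
Proof.
by move=> sF sG i j; under eq_fun do rewrite mxE; exact: smoothD.
Qed.

Lemma mxsmoothM r s u (F : V -> 'M[C]_(r, s)) (G : V -> 'M[C]_(s, u)) :
  mxsmooth F -> mxsmooth G -> mxsmooth (fun q => F q *m G q).
Proof.
move=> sF sG i j; under eq_fun do rewrite mxE.
by apply: smooth_sum => l; exact: smoothM.
Qed.

Lemma mxsmooth_adj r s (F : V -> 'M[C]_(r, s)) :
  mxsmooth F -> mxsmooth (fun q => (F q)^t*).
Proof.
by move=> sF i j; under eq_fun do rewrite !mxE; exact: smooth_conj.
Qed.

Lemma smooth_det r (F : V -> 'M[C]_r) :
  mxsmooth F -> smooth (fun q => \det (F q)).
Proof.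
move=> sF; apply: smooth_sum => s; apply: smoothM; first exact: smooth_cst.
by apply: smooth_prod => i; exact: sF.
Qed.

Lemma mxsmooth_adjugate r (F : V -> 'M[C]_r) :
  mxsmooth F -> mxsmooth (fun q => \adj (F q)).
Proof.
move=> sF i j; under eq_fun do rewrite mxE.
apply: smoothM; first exact: smooth_cst.
by apply: smooth_det => a b; under eq_fun do rewrite !mxE; exact: sF.
Qed.

Lemma mxsmooth_inv r (F : V -> 'M[C]_r) :
  (forall q, F q \in unitmx) -> mxsmooth F -> mxsmooth (fun q => invmx (F q)).
Proof.
move=> uF sF i j; under eq_fun do rewrite /invmx uF mxE.
apply: smoothM; last exact: mxsmooth_adjugate.
by apply: smoothV => [q|]; [rewrite -unitfE; exact: uF|exact: smooth_det].
Qed.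

Lemma mxsmooth_near_unit r (F : V -> 'M[C]_r) p :
  mxsmooth F -> F p \in unitmx -> \forall q \near p, F q \in unitmx.
Proof.
move=> sF uF.
have : \forall q \near p, \det (F q) != 0.
  apply: smooth_near_neq0; first exact: smooth_det.
  by rewrite -unitfE -unitmxE.
by apply: filterS => q; rewrite unitmxE unitfE.
Qed.

Lemma near_mxderivable p r s (F G : V -> 'M[C]_(r, s)) : {near p, F =1 G} ->
  mxderivable p F -> mxderivable p G.
Proof.
move=> FG dF v i j; apply: near_Cderivable (dF v i j).
by apply: filterS FG => q ->.
Qed.

Lemma CderivableD p v f g : Cderivable p v f -> Cderivable p v g ->
  Cderivable p v (fun q : V => f q + g q).
Proof.
move=> [rf jf] [rg jg]; split.
  by under eq_fun do rewrite Re_add; exact: derivable_add.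
by under eq_fun do rewrite Im_add; exact: derivable_add.
Qed.

Lemma Cderivable_sum (I : Type) (r : seq I) (F : I -> V -> C) p v :
  (forall i, Cderivable p v (F i)) ->
  Cderivable p v (fun q => \sum_(i <- r) F i q).
Proof.
move=> sF; elim: r => [|i r IHr].
  by under eq_fun do rewrite big_nil; exact/smooth_Cderivable/smooth_cst.
by under eq_fun do rewrite big_cons; exact: (CderivableD (sF i) IHr).
Qed.

Lemma Cderive_cst p v (a : C) : Cderive v (fun _ : V => a) p = 0.
Proof. by rewrite /Cderive !derive_cst. Qed.

Lemma Cderive_sum (I : Type) (r : seq I) (F : I -> V -> C) p v :
  (forall i, Cderivable p v (F i)) ->
  Cderive v (fun q => \sum_(i <- r) F i q) p = \sum_(i <- r) Cderive v (F i) p.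
Proof.
move=> sF; elim: r => [|i r IHr].
  by under eq_fun do rewrite big_nil; rewrite big_nil Cderive_cst.
under eq_fun do rewrite big_cons; rewrite big_cons -IHr.
by apply: CderiveD => //; exact: Cderivable_sum.
Qed.

Lemma mxderivableM p r s u (F : V -> 'M[C]_(r, s)) (G : V -> 'M[C]_(s, u)) :
  mxderivable p F -> mxderivable p G -> mxderivable p (fun q => F q *m G q).
Proof.
move=> sF sG v i j; under eq_fun do rewrite mxE.
by apply: Cderivable_sum => l; exact: CderivableM.
Qed.

(** [invmx] is rational only near a point where the determinant does not vanish,
    whence the passage through a function that agrees with it near [p]. *)
Lemma mxderivable_inv p r (F : V -> 'M[C]_r) :
  F p \in unitmx -> mxsmooth F -> mxderivable p (fun q => invmx (F q)).
Proof.
move=> uF sF.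
apply: (@near_mxderivable _ _ _ (fun q => (\det (F q))^-1 *: \adj (F q))).
  apply: filterS (mxsmooth_near_unit sF uF) => q uq.
  by rewrite /invmx uq.
move=> v i j; under eq_fun do rewrite mxE.
apply: CderivableM; last exact/smooth_Cderivable/mxsmooth_adjugate.
apply: CderivableV; last exact/smooth_Cderivable/smooth_det.
by rewrite -unitfE -unitmxE.
Qed.

End MatrixCalculus.

(** * Wirtinger derivatives with respect to the conjugate coordinates *)

Section Wirtinger.
Context {R : realType} {N k : nat}.
Local Notation C := R[i].
Local Notation m := (N - k)%N.
Local Notation cspace2 := (@cspace2 R N k).
Local Notation dzbar := (@dzbar R N k).

Lemma smooth_dzbar t (f : cspace2 -> C) : smooth f -> smooth (dzbar t f).
Proof.
move=> sf; apply: smoothM; last exact: smooth_cst.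
apply: smoothD; first exact: smooth_Cderive.
by apply: smoothM; [exact: smooth_cst|exact: smooth_Cderive].
Qed.

Lemma mxsmooth_dzbar r s t (F : cspace2 -> 'M[C]_(r, s)) :
  mxsmooth F -> mxsmooth (dzbarmx t F).
Proof.
by move=> sF i j; under eq_fun do rewrite mxE; exact: smooth_dzbar.
Qed.

Lemma near_dzbarmx p t r s (F G : cspace2 -> 'M[C]_(r, s)) : {near p, F =1 G} ->
  dzbarmx t F p = dzbarmx t G p.
Proof.
move=> FG; apply/matrixP => i j; rewrite !mxE /Defs.dzbar.
have FGij : {near p, (fun q => F q i j) =1 (fun q => G q i j)}.
  by apply: filterS FG => q ->.
by rewrite !(near_Cderive _ FGij).
Qed.

Lemma eq_dzbarmx t r s (F G : cspace2 -> 'M[C]_(r, s)) :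
  F =1 G -> dzbarmx t F = dzbarmx t G.
Proof. by move=> /funext ->. Qed.

Lemma dzbarmx_cst t r s (A : 'M[C]_(r, s)) p :
  dzbarmx t (fun _ : cspace2 => A) p = 0.
Proof.
by apply/matrixP => i j; rewrite !mxE /Defs.dzbar !Cderive_cst mulr0 addr0 mul0r.
Qed.

Lemma dzbarmxD t r s (F G : cspace2 -> 'M[C]_(r, s)) p :
  mxderivable p F -> mxderivable p G ->
  dzbarmx t (fun q => F q + G q) p = dzbarmx t F p + dzbarmx t G p.
Proof.
move=> dF dG; apply/matrixP => i j; rewrite !mxE /Defs.dzbar.
under eq_fun do rewrite mxE.
rewrite !(CderiveD (dF _ i j) (dG _ i j)) -mulrDl; congr (_ / _).
by rewrite mulrDr addrACA.
Qed.

Lemma dzbarmxM t r s u (F : cspace2 -> 'M[C]_(r, s))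
    (G : cspace2 -> 'M[C]_(s, u)) p :
  mxderivable p F -> mxderivable p G ->
  dzbarmx t (fun q => F q *m G q) p =
    dzbarmx t F p *m G p + F p *m dzbarmx t G p.
Proof.
move=> dF dG; apply/matrixP => i j; rewrite !mxE /Defs.dzbar -big_split.
under eq_fun do rewrite mxE.
have dFG v l : Cderivable p v (fun q => F q i l * G q l j).
  exact: CderivableM (dF v i l) (dG v l j).
rewrite !Cderive_sum // mulr_sumr -big_split mulr_suml.
apply: eq_bigr => l _ /=; rewrite !mxE /Defs.dzbar.
rewrite !(CderiveM (dF _ i l) (dG _ l j)).
have leibniz (K : comNzRingType) (a b c d f g h w : K) :
    (a * g + f * b + w * (c * g + f * d)) * h =
    (a + w * c) * h * g + f * ((b + w * d) * h) by ring.
exact: leibniz.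
Qed.

Lemma coords_smooth n i j :
  [/\ continuously_derivable n (fun q : cspace2 => q.1.1 i j),
      continuously_derivable n (fun q : cspace2 => q.1.2 i j),
      continuously_derivable n (fun q : cspace2 => q.2.1 i j) &
      continuously_derivable n (fun q : cspace2 => q.2.2 i j)].
Proof.
pose MR : normedModType R := 'M[R]_(k, m).
have cfst (T : normedModType R) (g : T -> MR * MR) :
    continuous g -> continuous (fun q => (g q).1 i j).
  move=> cg q; apply: (cvg_comp (fun q => (g q).1) (fun M : MR => M i j)).
    by apply: (cvg_comp g fst (cg q)); exact: cvg_fst.
  exact: coord_continuous.
have csnd (T : normedModType R) (g : T -> MR * MR) :
    continuous g -> continuous (fun q => (g q).2 i j).
  move=> cg q; apply: (cvg_comp (fun q => (g q).2) (fun M : MR => M i j)).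
    by apply: (cvg_comp g snd (cg q)); exact: cvg_snd.
  exact: coord_continuous.
have c1 : continuous (fun q : cspace2 => q.1) by move=> q; exact: cvg_fst.
have c2 : continuous (fun q : cspace2 => q.2) by move=> q; exact: cvg_snd.
by split; apply: cd_linear => [|h p v]; rewrite ?mxE //;
  [exact: cfst c1|exact: csnd c1|exact: cfst c2|exact: csnd c2].
Qed.

Lemma mxsmooth_zco : mxsmooth (@zco R N k).
Proof.
move=> i j n; have [? ? _ _] := coords_smooth n i j.
by split; under eq_fun do rewrite mxE.
Qed.

Lemma mxsmooth_wco : mxsmooth (@wco R N k).
Proof.
move=> i j n; have [_ _ ? ?] := coords_smooth n i j.
by split; under eq_fun do rewrite mxE.
Qed.

Lemma Cderive_zco v p i j :
  Cderive v (fun q : cspace2 => zco q i j) p = zco v i j.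
Proof.
by rewrite mxE /Cderive; congr (_ +i* _); under eq_fun do rewrite mxE /=;
  apply: derive_linear => h q w; rewrite !mxE.
Qed.

Lemma Cderive_wco v p i j :
  Cderive v (fun q : cspace2 => wco q i j) p = wco v i j.
Proof.
by rewrite mxE /Cderive; congr (_ +i* _); under eq_fun do rewrite mxE /=;
  apply: derive_linear => h q w; rewrite !mxE.
Qed.

Lemma zco_dx (t : tidx) : zco (dx t : cspace2) =
  if t.1 then 0 else delta_mx t.2.1 t.2.2.
Proof.
by apply/matrixP => i j; rewrite /dx; case: t => -[] [a b] /=; rewrite !mxE //;
  case: (_ && _).
Qed.

Lemma zco_dy (t : tidx) : zco (dy t : cspace2) = 'i *: zco (dx t : cspace2).
Proof.
apply/matrixP => i j; rewrite /dx /dy; case: t => -[] [a b] /=; rewrite !mxE //=;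
  by simpc.
Qed.

Lemma wco_dy (t : tidx) : wco (dy t : cspace2) = 'i *: wco (dx t : cspace2).
Proof.
apply/matrixP => i j; rewrite /dx /dy; case: t => -[] [a b] /=; rewrite !mxE //=;
  by simpc.
Qed.

Lemma dzbarmx_zco t p : dzbarmx t (@zco R N k) p = 0.
Proof.
apply/matrixP => i j; rewrite mxE /Defs.dzbar !Cderive_zco zco_dy.
move: (zco _) => e; rewrite !mxE mulrA -expr2 sqr_i mulN1r.
by rewrite subrr mul0r.
Qed.

Lemma dzbarmx_wco t p : dzbarmx t (@wco R N k) p = 0.
Proof.
apply/matrixP => i j; rewrite mxE /Defs.dzbar !Cderive_wco wco_dy.
move: (wco _) => e; rewrite !mxE mulrA -expr2 sqr_i mulN1r.
by rewrite subrr mul0r.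
Qed.

Lemma dzbarmx_zco_adj t p : dzbarmx t (fun q : cspace2 => (zco q)^t*) p =
  if t.1 then 0 else delta_mx t.2.2 t.2.1.
Proof.
have Dconj (V : normedModType R) (f : V -> C) q v : Cderivable q v f ->
    Cderive v (fun x => (f x)^* ) q = (Cderive v f q)^*.
  move=> [rf jf]; rewrite /Cderive; congr (_ +i* _).
    by congr ('D_v _ q); apply/funext => x; case: (f x).
  by rewrite -derive_oppf //; congr ('D_v _ q); apply/funext => x; case: (f x).
apply/matrixP => i j; rewrite mxE /Defs.dzbar.
under eq_fun do rewrite 2!mxE.
rewrite !Dconj; try exact/smooth_Cderivable/mxsmooth_zco.
rewrite !Cderive_zco zco_dy zco_dx.
have conj0 : (0 : C)^* = 0 by rewrite /conjc /= oppr0.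
have conj1 : (1 : C)^* = 1 by rewrite /conjc /= oppr0.
have conji : ('i : C)^* = - 'i by rewrite /conjc; simpc.
case: t.1; rewrite !mxE; first by rewrite mulr0 conj0 mulr0 addr0 mul0r.
rewrite andbC; case: (_ && _); last by rewrite mulr0 conj0 mulr0 addr0 mul0r.
rewrite mulr1 conj1 conji mulrN -expr2 sqr_i opprK.
by rewrite -[X in X / _]/(2%:R) divff // pnatr_eq0.
Qed.

End Wirtinger.

#[local] Hint Resolve mxsmooth_derivable mxsmooth_cst mxsmooth_zco mxsmooth_wco
  mxsmoothD mxsmoothM mxsmooth_adj : core.

(** * The orthogonal projection on a row space *)

(** The Moore-Penrose inverse of a matrix with independent rows.  Like [drinv]
    below it is locked, as rewriting with the associativity of the product would
    otherwise unfold it. *)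
HB.lock Definition rinv (C : numClosedFieldType) k N (A : 'M[C]_(k, N)) :
    'M[C]_(N, k) := A^t* *m invmx (A *m A^t*).

Section PseudoInverse.
Context {C : numClosedFieldType}.

Lemma adjmxM r s u (A : 'M[C]_(r, s)) (B : 'M[C]_(s, u)) :
  (A *m B)^t* = B^t* *m A^t*.
Proof. by rewrite trmx_mul map_mxM. Qed.

Lemma adjmx_unit r (A : 'M[C]_r) : A \in unitmx -> A^t* \in unitmx.
Proof. by rewrite map_unitmx unitmx_tr. Qed.

(** The Hermitian form is positive definite: a row u with u A A^* = 0 gives a
    vector u A which lies in the row space of A and is orthogonal to it. *)
Lemma gram_unit k N (A : 'M[C]_(k, N)) : row_free A -> A *m A^t* \in unitmx.
Proof.
move=> fA; rewrite -row_free_unit -kermx_eq0; apply/eqP.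
set u := kermx _; have /orthomx1P uA : u *m A *m A^t* = 0.
  by rewrite -mulmxA mulmx_ker.
have : (u *m A <= (0 : 'M_N))%MS.
  by rewrite -(orthomx_ortho_disj A) sub_capmx submxMl.
by rewrite submx0 => /eqP uA0; apply: (row_free_inj fA); rewrite uA0 mul0mx.
Qed.

Lemma rinvE k N (A : 'M[C]_(k, N)) : rinv A = A^t* *m invmx (A *m A^t*).
Proof. by rewrite rinv.unlock. Qed.

Lemma mulmx_rinv k N (A : 'M[C]_(k, N)) : row_free A -> A *m rinv A = 1%:M.
Proof. by move=> fA; rewrite rinvE mulmxA mulmxV // gram_unit. Qed.

Lemma rinv_adj k N (A : 'M[C]_(k, N)) :
  row_free A -> rinv A *m A *m A^t* = A^t*.
Proof. by move=> fA; rewrite rinvE -!mulmxA mulVmx ?mulmx1 // gram_unit. Qed.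

Lemma rinv_mull k N (T : 'M[C]_k) (A : 'M[C]_(k, N)) :
  T \in unitmx -> row_free A -> rinv (T *m A) = rinv A *m invmx T.
Proof.
move=> uT fA; have uG := gram_unit fA.
have fTA : row_free (T *m A) by rewrite /row_free mxrankMfree // mxrank_unit.
have uTG := gram_unit fTA.
apply: (can_inj (mulmxK uTG)); rewrite mulmxA rinv_adj // adjmxM.
rewrite -[T *m A *m _]mulmxA -[RHS]mulmxA mulKmx //.
by rewrite [A *m _]mulmxA 2!mulmxA rinv_adj.
Qed.

(** P A is the identity on the row space of A, and the rows of 1 - P A are
    orthogonal to it since P A A^* = A^*. *)
Lemma proj_ortho_rinv k N (V : 'M[C]_N) (A : 'M[C]_(k, N)) :
  row_free A -> (V :=: A)%MS -> proj_ortho V = rinv A *m A.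
Proof.
move=> fA VA; rewrite -[LHS]mul1mx -[1%:M in LHS](subrK (rinv A *m A)) mulmxDl.
rewrite proj_ortho_0 ?add0r ?proj_ortho_id ?VA ?submxMl //.
have /submxP[D ->] : (V <= A)%MS by rewrite VA.
apply/orthomx1P.
by rewrite adjmxM mulmxA mulmxBl mul1mx rinv_adj // subrr mul0mx.
Qed.

End PseudoInverse.

(** * Leibniz rules for matrices of smooth functions *)

Section Calculus.
Context {R : realType} {N k : nat}.
Local Notation C := R[i].
Local Notation cspace2 := (@cspace2 R N k).
Implicit Types (p q : cspace2) (t u : @tidx N k).

Lemma mxsmoothN r s (F : cspace2 -> 'M[C]_(r, s)) :
  mxsmooth F -> mxsmooth (fun q => - F q).
Proof.
move=> sF; suff -> : (fun q => - F q) = (fun q => - 1%:M *m F q) by auto.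
by apply/funext => q; rewrite mulNmx mul1mx.
Qed.

Lemma dzbarmxMl r s r' t (A : 'M[C]_(r, s)) (F : cspace2 -> 'M[C]_(s, r')) p :
  mxsmooth F -> dzbarmx t (fun q => A *m F q) p = A *m dzbarmx t F p.
Proof. by move=> sF; rewrite dzbarmxM ?dzbarmx_cst ?mul0mx ?add0r //; auto. Qed.

Lemma dzbarmxMr r s r' t (A : 'M[C]_(s, r')) (F : cspace2 -> 'M[C]_(r, s)) p :
  mxsmooth F -> dzbarmx t (fun q => F q *m A) p = dzbarmx t F p *m A.
Proof. by move=> sF; rewrite dzbarmxM ?dzbarmx_cst ?mulmx0 ?addr0 //; auto. Qed.

Lemma dzbarmxCB r s t (A : 'M[C]_(r, s)) (F : cspace2 -> 'M[C]_(r, s)) p :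
  mxsmooth F -> dzbarmx t (fun q => A - F q) p = - dzbarmx t F p.
Proof.
move=> sF; rewrite (eq_dzbarmx _ (G := fun q => A + (- 1%:M) *m F q)).
  by rewrite dzbarmxD ?dzbarmx_cst ?add0r ?dzbarmxMl ?mulNmx ?mul1mx //; auto.
by move=> q; rewrite mulNmx mul1mx.
Qed.

(** Obtained by differentiating F^-1 F = 1. *)
Lemma dzbarmx_inv t r (F : cspace2 -> 'M[C]_r) p :
  (forall q, F q \in unitmx) -> mxsmooth F ->
  dzbarmx t (fun q => invmx (F q)) p =
    - (invmx (F p) *m dzbarmx t F p *m invmx (F p)).
Proof.
move=> uF sF; have sV := mxsmooth_inv uF sF.
have : dzbarmx t (fun q => invmx (F q) *m F q) p = 0.
  have -> : (fun q => invmx (F q) *m F q) = (fun=> 1%:M).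
    by apply/funext => q; rewrite mulVmx.
  exact: dzbarmx_cst.
rewrite dzbarmxM; [|by auto|by auto].
move/eqP; rewrite addr_eq0 => /eqP /(congr1 (fun M => M *m invmx (F p))).
by rewrite mulmxK // mulNmx.
Qed.

End Calculus.

(** * Derivatives of the right inverse of a holomorphic frame *)

(** The derivative of [rinv A] in a direction where the derivative of A is 0 and
    the one of its adjoint is E, see [dzbarmx_rinv]. *)
HB.lock Definition drinv (C : numClosedFieldType) r n (A : 'M[C]_(r, n))
    (E : 'M[C]_(n, r)) : 'M[C]_(n, r) :=
  (1%:M - rinv A *m A) *m E *m invmx (A *m A^t*).

Lemma drinvE (C : numClosedFieldType) r n (A : 'M[C]_(r, n)) (E : 'M[C]_(n, r)) :
  drinv A E = (1%:M - rinv A *m A) *m E *m invmx (A *m A^t*).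
Proof. by rewrite drinv.unlock. Qed.

Lemma mulmx_drinv (C : numClosedFieldType) r n (A : 'M[C]_(r, n))
  (E : 'M[C]_(n, r)) : row_free A -> A *m drinv A E = 0.
Proof.
move=> fA; rewrite drinvE !mulmxA mulmxBr mulmx1 mulmxA mulmx_rinv //.
by rewrite mul1mx subrr !mul0mx.
Qed.

Section HolomorphicFrame.
Context {R : realType} {N k : nat}.
Local Notation C := R[i].
Local Notation cspace2 := (@cspace2 R N k).
Implicit Types (p q : cspace2) (t u : @tidx N k).
(* [A] is holomorphic and the derivatives [E t] of its adjoint are constant, as is
   the case for a frame which is affine in the coordinates. *)
Context (r n : nat) (A : cspace2 -> 'M[C]_(r, n)).
Context (E : @tidx N k -> 'M[C]_(n, r)).
Context (fA : forall q, row_free (A q)) (sA : mxsmooth A).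
Context (hA : forall t p, dzbarmx t A p = 0).
Context (dA : forall t p, dzbarmx t (fun q => (A q)^t*) p = E t).

Let uG q : A q *m (A q)^t* \in unitmx := gram_unit (fA q).

Lemma mxsmooth_gramV : mxsmooth (fun q => invmx (A q *m (A q)^t*)).
Proof. by apply: (mxsmooth_inv uG); auto. Qed.
#[local] Hint Resolve mxsmooth_gramV : core.

Lemma mxsmooth_rinv : mxsmooth (fun q => rinv (A q)).
Proof.
suff -> : (fun q => rinv (A q)) = (fun q => (A q)^t* *m invmx (A q *m (A q)^t*)).
  by auto.
by apply/funext => q; exact: rinvE.
Qed.
#[local] Hint Resolve mxsmooth_rinv : core.

Lemma dzbarmx_gramV t p : dzbarmx t (fun q => invmx (A q *m (A q)^t*)) p =
  - (invmx (A p *m (A p)^t*) *m A p *m E t *m invmx (A p *m (A p)^t*)).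
Proof.
rewrite (dzbarmx_inv t p uG); last by auto.
rewrite dzbarmxM; [|by auto|by auto].
by rewrite dA hA mul0mx add0r !mulmxA.
Qed.

Lemma dzbarmx_rinv t p : dzbarmx t (fun q => rinv (A q)) p = drinv (A p) (E t).
Proof.
rewrite (eq_dzbarmx _
  (G := fun q => (A q)^t* *m invmx (A q *m (A q)^t*))); last first.
  by move=> q; exact: rinvE.
rewrite dzbarmxM; [|by auto|by auto].
by rewrite dA dzbarmx_gramV mulmxN drinvE rinvE !mulmxBl mul1mx !mulmxA.
Qed.

Lemma dzbarmx_proj t p :
  dzbarmx t (fun q => rinv (A q) *m A q) p = drinv (A p) (E t) *m A p.
Proof.
rewrite dzbarmxM; [|by auto|by auto].
by rewrite hA mulmx0 addr0 dzbarmx_rinv.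
Qed.

(** Derivatives of E do not occur, and the two other factors of [drinv]
    contribute the two terms, which are exchanged with t and u. *)
Lemma dzbarmx_drinv t u p :
  dzbarmx t (fun q => drinv (A q) (E u)) p =
  - (drinv (A p) (E t) *m A p *m E u *m invmx (A p *m (A p)^t*)
     + drinv (A p) (E u) *m A p *m E t *m invmx (A p *m (A p)^t*)).
Proof.
rewrite (eq_dzbarmx _ (fun q => drinvE (A q) (E u))).
have sX : mxsmooth (fun q => 1%:M - rinv (A q) *m A q).
  by apply: mxsmoothD => //; apply: mxsmoothN; auto.
rewrite dzbarmxM; [|by auto|by auto].
rewrite dzbarmxMr // dzbarmxCB; last by auto.
rewrite dzbarmx_proj dzbarmx_gramV.
rewrite [drinv (A p) (E u)]drinvE.
move: (A p) (invmx _) (drinv _ _) (1%:M - rinv (A p) *m A p) => a K D X.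
by rewrite mulmxN !mulNmx -opprD !mulmxA.
Qed.

Lemma dzbarmx_drinvC t u p :
  dzbarmx t (fun q => drinv (A q) (E u)) p =
  dzbarmx u (fun q => drinv (A q) (E t)) p.
Proof.
rewrite (dzbarmx_drinv t u p) (dzbarmx_drinv u t p).
move: (drinv (A p) (E t) *m _ *m _ *m _)
  (drinv (A p) (E u) *m _ *m _ *m _) => X Y.
by rewrite addrC.
Qed.

Lemma mxsmooth_drinv t : mxsmooth (fun q => drinv (A q) (E t)).
Proof.
rewrite (_ : (fun q => _) = dzbarmx t (fun q => rinv (A q))).
  exact: mxsmooth_dzbar.
by apply/funext => q; rewrite dzbarmx_rinv.
Qed.

(** The left-hand side is the expression which defines gamma_1 on a constant
    vector w; it simplifies because A P = 1. *)
Lemma dzbarmx_compl s t (w : 'M[C]_(s, n)) p :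
  - (dzbarmx t (fun q => w - w *m (rinv (A q) *m A q)) p *m (rinv (A p) *m A p)) =
  w *m drinv (A p) (E t) *m A p.
Proof.
rewrite dzbarmxCB; last by auto.
rewrite dzbarmxMl; last by auto.
rewrite dzbarmx_proj mulNmx opprK !mulmxA.
by rewrite -(mulmxA _ (A p) (rinv _)) mulmx_rinv // mulmx1.
Qed.

End HolomorphicFrame.

(** * The canonical frames over a chart *)

Section Frames.
Context {R : realType} {N k : nat}.
Local Notation C := R[i].
Local Notation m := (N - k)%N.
Local Notation cspace2 := (@cspace2 R N k).
Local Notation chart := (@chart R N k).
Implicit Types (c d : chart) (p q : cspace2) (t u : @tidx N k).

Lemma Hcoord_frame r c Z (M : 'M[C]_(r, k)) : Hcoord c Z (M *m frame c Z) = M.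
Proof. by rewrite /Hcoord -mulmxA mulmxVp ?frame_free // mulmx1. Qed.

Lemma piH_pt c Z : piH (pt c Z) = rinv (frame c Z) *m frame c Z.
Proof. by apply: proj_ortho_rinv; [exact: frame_free|exact: genmxE]. Qed.

Lemma pt_eqmx c d Z W : pt c Z = pt d W -> (frame d W == frame c Z)%MS.
Proof.
by move=> /(congr1 val) /= /esym E; apply/genmxP.
Qed.

Lemma pt_transition c d Z W : pt c Z = pt d W ->
  exists2 T, T \in unitmx & frame d W = T *m frame c Z.
Proof.
move=> /pt_eqmx/andP[/submxP[T hT] /submxP[S hS]]; exists T => //.
have /mulmx1_unit[] // : T *m S = 1%:M.
apply: mulmx1C; apply: (row_free_inj (frame_free c Z)).
by rewrite -mulmxA -hT -hS mul1mx.
Qed.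

Lemma row_full_chart c Z : (k <= N)%N -> row_full (col_mx (frame c Z) (chB c)).
Proof.
move=> kN; rewrite /row_full.
have -> : col_mx (frame c Z) (chB c) =
    block_mx 1%:M Z 0 1%:M *m col_mx (chA c) (chB c).
  by rewrite mul_block_col !mul1mx mul0mx add0r.
rewrite mxrankMfree ?chart_free // mxrank_unit ?subnKC //.
by rewrite unitmxE det_ublock !det1 mulr1 unitr1.
Qed.

(** [Fcoord c Z v] gives the coordinates of v modulo the row space of the
    frame. *)
Lemma Fcoord_frame r c Z (v : 'M[C]_(r, N)) : (k <= N)%N ->
  exists S : 'M[C]_(r, k), v = S *m frame c Z + Fcoord c Z v *m chB c.
Proof.
move=> kN; set M := col_mx (frame c Z) (chB c).
exists (lsubmx (v *m pinvmx M)); rewrite -mul_row_col hsubmxK.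
by rewrite mulmxKpV // submx_full // row_full_chart.
Qed.


Local Notation fr c q := (frame c (zco q)).

(** The derivatives of the adjoint of the frame of H_z; those in the zeta
    directions vanish. *)
Definition dframe c t : 'M[C]_(N, k) :=
  if t.1 then 0 else (chB c)^t* *m delta_mx t.2.2 t.2.1.

Lemma mxsmooth_frame c : mxsmooth (fun q => fr c q).
Proof. by rewrite /frame; auto. Qed.

Lemma mxsmooth_frame_w c : mxsmooth (fun q : cspace2 => frame c (wco q)).
Proof. by rewrite /frame; auto. Qed.

Lemma dzbarmx_frame c t p : dzbarmx t (fun q => fr c q) p = 0.
Proof.
rewrite /frame dzbarmxD; [|by auto|by auto].
by rewrite dzbarmx_cst dzbarmxMr ?dzbarmx_zco ?mul0mx ?addr0.
Qed.

Lemma dzbarmx_frame_w c t p :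
  dzbarmx t (fun q : cspace2 => frame c (wco q)) p = 0.
Proof.
rewrite /frame dzbarmxD; [|by auto|by auto].
by rewrite dzbarmx_cst dzbarmxMr ?dzbarmx_wco ?mul0mx ?addr0.
Qed.

Lemma dzbarmx_frame_adj c t p :
  dzbarmx t (fun q => (fr c q)^t*) p = dframe c t.
Proof.
rewrite (eq_dzbarmx _
  (G := fun q => (chA c)^t* + (chB c)^t* *m (zco q)^t*)); last first.
  by move=> q; rewrite /frame linearD /= map_mxD adjmxM.
rewrite dzbarmxD; [|by auto|by auto].
rewrite dzbarmx_cst add0r dzbarmxMl; last by auto.
by rewrite dzbarmx_zco_adj /dframe; case: t.1; rewrite ?mulmx0.
Qed.



Lemma fr_free c q : row_free (fr c q).
Proof. exact: frame_free. Qed.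

Lemma gamma0E c c' p :
  gamma0 c c' [::] p = frame c' (wco p) *m rinv (fr c p).
Proof. by rewrite /gamma0 piH_pt mulmxA Hcoord_frame. Qed.

Lemma gamma1_mxE c c' e t p :
  gamma1_mx c c' e t p = delta_mx e.1 e.2 *m chB c *m drinv (fr c p) (dframe c t).
Proof.
apply/row_matrixP => i; rewrite rowK /gamma1_at.
set w := delta_mx 0 i *m delta_mx e.1 e.2 *m chB c.
rewrite (eq_dzbarmx _
  (G := fun q => w - w *m (rinv (fr c q) *m fr c q))); last first.
  by move=> q; rewrite /phi piH_pt.
rewrite piH_pt (dzbarmx_compl (fr_free c) (mxsmooth_frame c)
  (dzbarmx_frame c) (dzbarmx_frame_adj c)).
by rewrite Hcoord_frame rowE !mulmxA.
Qed.

End Frames.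

#[local] Hint Resolve mxsmooth_frame mxsmooth_frame_w : core.

(** * Change of charts *)

(** The factor 1 - P A depends only on the row space of A, and A A^* becomes
    T A A^* T^*. *)
Lemma drinv_mull (C : numClosedFieldType) r n (T : 'M[C]_r) (A : 'M[C]_(r, n))
    (E : 'M[C]_(n, r)) : T \in unitmx -> row_free A ->
  drinv (T *m A) E *m T = (1%:M - rinv A *m A) *m (E *m invmx (T^t*)) *m
                          invmx (A *m A^t*).
Proof.
move=> uT fA; have uG := gram_unit fA; have uT' := adjmx_unit uT.
rewrite drinvE rinv_mull // -[rinv A *m _ *m _]mulmxA mulKmx //.
have -> : T *m A *m (T *m A)^t* = T *m (A *m A^t*) *m T^t*.
  by rewrite adjmxM !mulmxA.
move: (1%:M - _) (A *m _) (T^t*) uG uT' => X G S uG uS.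
have uTGS : T *m G *m S \in unitmx by rewrite !unitmx_mul uT uG.
have VT : invmx (T *m G *m S) *m T = invmx S *m invmx G.
  apply: (can_inj (mulmxK uG)); apply: (can_inj (mulmxK uS)).
  by rewrite mulmxKV // mulVmx // -!mulmxA (mulmxA T) mulVmx.
by move: (invmx (T *m G *m S)) VT => V VT; rewrite -!mulmxA VT.
Qed.

Section Transition.
Context {R : realType} {N k : nat} (kN : (k <= N)%N).
Local Notation C := R[i].
Local Notation m := (N - k)%N.
Local Notation cspace2 := (@cspace2 R N k).
Local Notation chart := (@chart R N k).
Implicit Types (c d : chart) (p q : cspace2) (t u : @tidx N k).

Lemma adjmxV r (A : 'M[C]_r) : (invmx A)^t* = invmx (A^t*).
Proof. by rewrite trmx_inv map_invmx. Qed.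

Lemma mxsmooth_submx r s1 s2 (F : cspace2 -> 'M[C]_(r, s1 + s2)) :
  mxsmooth F -> mxsmooth (fun q => lsubmx (F q)) /\
                mxsmooth (fun q => rsubmx (F q)).
Proof.
by move=> sF; split=> i j; under eq_fun do rewrite mxE; exact: sF.
Qed.

(** The chain rule for the transition map tau, modulo the row space of A.  Write
    the frame of d as U chA + W chB, so that U tau = W wherever U is invertible;
    differentiating the adjoint of this equation at q gives
    (dbar tau^* ) T^* = dbar W^* - Z^* dbar U^*, with Z the coordinates of p.
    Multiplied by chB^*, the right-hand side is dbar (U chA + W chB)^* minus
    A^* dbar U^*, and 1 - P A annihilates A^*. *)
Lemma transition_derivative c d p q u T :
  T \in unitmx -> frame d (zco q) = T *m frame c (zco p) ->
  let A := frame c (zco p) in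
  let Y := dzbarmx u (fun q' => (Defs.coord c (frame d (zco q')))^t*) q in
  (1%:M - rinv A *m A) *m ((chB c)^t* *m Y *m T^t*) =
  (1%:M - rinv A *m A) *m dframe d u.
Proof.
move=> uT hT A Y.
set M := col_mx (chA c) (chB c).
have fM : row_full M by apply/eqP; rewrite (eqP (chart_free c)) subnKC.
pose UW q' := frame d (zco q') *m pinvmx M.
have sUW : mxsmooth UW by rewrite /UW; auto.
have [sU sW] := mxsmooth_submx sUW.
set U := fun q' => lsubmx (UW q') in sU.
set W := fun q' => rsubmx (UW q') in sW.
(* [col_mx (chA c) (chB c)] is a basis of C^N. *)
have dec q' : frame d (zco q') = U q' *m chA c + W q' *m chB c.
  by rewrite -mul_row_col hsubmxK mulmxKpV // submx_full.
have UWq : UW q = row_mx T (T *m zco p).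
  rewrite /UW hT [frame c _](_ : _ = row_mx 1%:M (zco p) *m M).
    by rewrite -!mulmxA mulmxVp ?chart_free // mulmx1 mul_mx_row mulmx1.
  by rewrite mul_row_col mul1mx.
have Uq : U q = T by rewrite /U UWq row_mxKl.
have Wq : W q = T *m zco p by rewrite /W UWq row_mxKr.
have uUq : (U q)^t* \in unitmx by rewrite Uq adjmx_unit.
have sUs : mxsmooth (fun q' => (U q')^t*) by auto.
have sWs : mxsmooth (fun q' => (W q')^t*) by auto.
pose X q' := (W q')^t* *m invmx ((U q')^t*).
have XE : (fun q' => (Defs.coord c (frame d (zco q')))^t*) = X.
  by apply/funext => q'; rewrite /Defs.coord adjmxM adjmxV.
have dX : mxderivable q X by apply: mxderivableM; [auto|exact: mxderivable_inv].
have dframeE : dframe d u = (chA c)^t* *m dzbarmx u (fun q' => (U q')^t*) q +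
                            (chB c)^t* *m dzbarmx u (fun q' => (W q')^t*) q.
  rewrite -(dzbarmx_frame_adj d u q) -!dzbarmxMl // -dzbarmxD; [|by auto|by auto].
  apply: (congr1 (fun F => dzbarmx u F q)); apply/funext => q'.
  by rewrite dec linearD /= map_mxD !adjmxM.
(* U need not be invertible everywhere: this holds because it is near q. *)
have : dzbarmx u (fun q' => X q' *m (U q')^t*) q =
       dzbarmx u (fun q' => (W q')^t*) q.
  apply: near_dzbarmx; apply: filterS (mxsmooth_near_unit sUs uUq) => q' uq'.
  by rewrite /X mulmxKV.
rewrite dzbarmxM; [|by auto|by auto].
rewrite [X q]/X Uq Wq adjmxM mulmxK ?adjmx_unit // dframeE.
rewrite /Y XE => <-.
have As : A^t* = (chA c)^t* + (chB c)^t* *m (zco p)^t*.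
  by rewrite /A /frame linearD /= map_mxD adjmxM.
have XA : (1%:M - rinv A *m A) *m A^t* = 0.
  by rewrite mulmxBl mul1mx rinv_adj ?subrr ?frame_free.
move: XA; rewrite As; move: (1%:M - rinv A *m A) (dzbarmx u X q)
  (dzbarmx u (fun q' => (U q')^t* ) q) (zco p) => E D1 D2 Z.
move: ((chA c)^t* ) ((chB c)^t* ) (T^t* ) (Z^t* ) => a b S z XA.
have -> : a *m D2 + b *m (D1 *m S + z *m D2) = b *m D1 *m S + (a + b *m z) *m D2.
  by rewrite mulmxDr mulmxDl addrCA !mulmxA.
by rewrite [RHS]mulmxDr [E *m (_ *m D2)]mulmxA XA mul0mx addr0.
Qed.

End Transition.

(** * Reindexing of finite sums *)

Lemma drinv_sum (C : numClosedFieldType) r n (A : 'M[C]_(r, n)) (I : finType)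
    (z : I -> C) (E : I -> 'M[C]_(n, r)) :
  \sum_i z i *: drinv A (E i) = drinv A (\sum_i z i *: E i).
Proof.
rewrite drinvE mulmx_sumr mulmx_suml; apply: eq_bigr => i _.
by rewrite drinvE; move: (1%:M - _) (invmx _) => X K; rewrite -scalemxAr -scalemxAl.
Qed.

Lemma sum_tuple0 (T : finType) (V : nmodType) (F : seq T -> V) :
  \sum_(l : 0.-tuple T) F l = F [::].
Proof. by rewrite (big_pred1 [tuple]) // => l; apply/esym/eqP; exact: tuple0. Qed.

Lemma sum_tuple2 (T : finType) (V : nmodType) (F : seq T -> V) :
  \sum_(l : 2.-tuple T) F l = \sum_x \sum_y F [:: x; y].
Proof.
rewrite pair_big /= (reindex (fun xy : T * T => [tuple xy.1; xy.2])) //=.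
exists (fun l : 2.-tuple T => (tnth l ord0, tnth l (lift ord0 ord0))).
  by case.
by case=> [[|x [|y []]]] //= ? _; apply: val_inj.
Qed.

Lemma sum_bool_pair (I : finType) (V : nmodType) (F : bool * I -> V) :
  \sum_t F t = \sum_i F (true, i) + \sum_i F (false, i).
Proof.
rewrite (eq_bigr (fun t => F (t.1, t.2))) => [|[] //].
by rewrite -(pair_bigA _ (fun b i => F (b, i))) big_bool.
Qed.

Lemma sum_delta_pair (K : pzRingType) r s (M : 'M[K]_(r, s)) :
  \sum_(e : 'I_r * 'I_s) M e.1 e.2 *: delta_mx e.1 e.2 = M.
Proof.
rewrite [RHS]matrix_sum_delta pair_bigA /=.
by apply: eq_bigr => -[].
Qed.

Lemma mul_delta_entry (K : pzRingType) r s r' s' (M : 'M[K]_(r, r'))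
    (L : 'M[K]_(s', s)) i j a b :
  (M *m delta_mx i j *m L) a b = M a i * L j b.
Proof.
rewrite -(mul_delta_mx (0 : 'I_1)) mulmxA -mulmxA -colE -rowE !mxE big_ord1.
by rewrite !mxE.
Qed.

(** * The components of gamma_0 + gamma_1 *)

Section Weight.
Context {R : realType} {N k : nat} (kN : (k <= N)%N).
Local Notation C := R[i].
Local Notation m := (N - k)%N.
Local Notation cspace2 := (@cspace2 R N k).
Local Notation chart := (@chart R N k).
Local Notation tidx := (@tidx N k).
Local Notation eidx := (@eidx N k).
Implicit Types (c d : chart) (p q : cspace2) (t u : tidx).
Local Notation fr c q := (frame c (zco q)).

(** The coefficients [change] between the d/d(zbar_t) are the derivatives of the
    conjugate of the transition map; only those of its z part matter, as
    [dframe] vanishes in the zeta directions. *)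
Lemma sum_dframe c d p q u c' d' :
  \sum_t change c c' d d' p q (inl t) (inl u) *: dframe c t =
  (chB c)^t* *m dzbarmx u (fun q' => (Defs.coord c (frame d (zco q')))^t*) q.
Proof.
set Y := dzbarmx u _ q.
apply: etrans (sum_bool_pair _) _; rewrite -[RHS]add0r; congr (_ + _).
  by apply: big1 => ij _; rewrite [dframe _ _]/= scaler0.
transitivity (\sum_(ij : eidx) Y^T ij.1 ij.2 *:
    ((chB c)^t* *m (delta_mx ij.1 ij.2)^T)).
  apply: eq_bigr => -[i j] _ /=; rewrite /dframe /= trmx_delta 2!mxE; congr (_ *: _).
  by congr (dzbar u _ q); apply/funext => q' /=; rewrite 2!mxE.
under eq_bigr do rewrite scalemxAr -linearZ.
rewrite -mulmx_sumr -linear_sum /= sum_delta_pair trmxK //.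
Qed.

Lemma sum_change_e c c' d d' p q (b : eidx) :
  \sum_(a : eidx) change c c' d d' p q (inr a) (inr b) *: delta_mx a.1 a.2 =
  Hcoord d' (wco q) (frame c' (wco p)) *m delta_mx b.1 b.2 *m
  Fcoord c (zco p) (chB d).
Proof.
rewrite -[RHS]sum_delta_pair; apply: eq_bigr => -[i j] _.
by rewrite mul_delta_entry.
Qed.

(** Both sides are delta_b chB_d (1 - P A) M for a common matrix M.  On the
    right-hand side [sum_change_e] produces the factor Fcoord chB_c in place of
    chB_d; these differ by a left multiple of A, which 1 - P A annihilates.  The
    sum over t is evaluated by [sum_dframe] and [transition_derivative]. *)
Lemma gamma1_change c c' d d' p q (b : eidx) u :
  same_point c c' d d' p q ->
  gamma1_mx d d' b u q *m Hcoord c (zco p) (frame d (zco q)) =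
  Hcoord c' (wco p) (frame d' (wco q)) *m
  \sum_(a : eidx) \sum_t (change c c' d d' p q (inr a) (inr b) *
    change c c' d d' p q (inl t) (inl u)) *: gamma1_mx c c' a t p.
Proof.
case=> /pt_transition[T uT hT] /pt_transition[T' uT' hT'].
have hTV : frame c' (wco p) = invmx T' *m frame d' (wco q).
  by rewrite hT' mulKmx.
have -> : \sum_(a : eidx) \sum_t (change c c' d d' p q (inr a) (inr b) *
    change c c' d d' p q (inl t) (inl u)) *: gamma1_mx c c' a t p =
  (\sum_(a : eidx) change c c' d d' p q (inr a) (inr b) *: delta_mx a.1 a.2) *m
  chB c *m (\sum_t change c c' d d' p q (inl t) (inl u) *:
              drinv (fr c p) (dframe c t)).
  rewrite 2!mulmx_suml; apply: eq_bigr => a _; rewrite mulmx_sumr.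
  apply: eq_bigr => t _; rewrite gamma1_mxE.
  move: (change _ _ _ _ _ _ _ _) (change _ _ _ _ _ _ _ _) (drinv _ _)
    (delta_mx _ _) => x y D E.
  by rewrite -scalemxAr -!scalemxAl scalerA mulrC.
rewrite drinv_sum sum_dframe sum_change_e.
have := transition_derivative kN u uT hT.
set Y := dzbarmx u _ q; move=> /= hY.
rewrite gamma1_mxE hTV Hcoord_frame hT' hT !Hcoord_frame.
rewrite -(mulmxA _ (drinv _ _)) drinv_mull ?frame_free // drinvE.
have [S hS] := Fcoord_frame c (zco p) (chB d) kN.
rewrite {1}hS.
have AX : fr c p *m (1%:M - rinv (fr c p) *m fr c p) = 0.
  by rewrite mulmxBr mulmx1 mulmxA mulmx_rinv ?frame_free // mul1mx subrr.
move: AX hY; move: (Fcoord _ _ _) (chB c) (dframe d u) => F B D.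
move: (fr c p) (invmx (fr c p *m _)) (1%:M - rinv (fr c p) *m fr c p) => A K X AX hY.
have uTs := adjmx_unit uT.
have XD : X *m (D *m invmx (T^t*)) = X *m (B^t* *m Y).
  by rewrite mulmxA -hY -mulmxA mulmxK.
rewrite XD.
have : A *m (X *m (B^t* *m Y) *m K) = 0 by rewrite !mulmxA AX !mul0mx.
move: (X *m _ *m K) => W AW.
by rewrite mulmxDr mulmxDl -!mulmxA AW !mulmx0 add0r mulKVmx.
Qed.

(** The matrix of eta times chB is B up to a left multiple of A, and
    A (dbar P) = 0. *)
Lemma sum_eta_gamma1 c c' p t :
  \sum_e Defs.eta c c' p e *: gamma1_mx c c' e t p =
  frame c' (wco p) *m drinv (fr c p) (dframe c t).
Proof.
have [S hS] := Fcoord_frame c (zco p) (frame c' (wco p)) kN.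
rewrite [in RHS]hS; under eq_bigr do rewrite gamma1_mxE /Defs.eta.
have := mulmx_drinv (dframe c t) (frame_free c (zco p)).
move: (fr c p) (drinv _ _) => A D AD.
rewrite mulmxDl -mulmxA AD mulmx0 add0r.
rewrite -[in RHS](sum_delta_pair (Fcoord _ _ _)) 2!mulmx_suml.
by apply: eq_bigr => e _; rewrite -!scalemxAl.
Qed.

Lemma dzbarmx_gamma0 c c' p t :
  dzbarmx t (gamma0 c c' [::]) p = frame c' (wco p) *m drinv (fr c p) (dframe c t).
Proof.
rewrite (eq_dzbarmx _ (gamma0E c c')).
have sP := mxsmooth_rinv (fr_free c) (mxsmooth_frame c).
rewrite dzbarmxM; [|by auto|by auto].
rewrite dzbarmx_frame_w mul0mx add0r; congr (_ *m _).
exact: (dzbarmx_rinv (fr_free c) (mxsmooth_frame c)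
  (dzbarmx_frame c) (dzbarmx_frame_adj c)).
Qed.

Lemma mxsmooth_gamma1_mx c c' e t : mxsmooth (gamma1_mx c c' e t).
Proof.
have -> : gamma1_mx c c' e t =
    fun p => delta_mx e.1 e.2 *m chB c *m drinv (fr c p) (dframe c t).
  by apply/funext => p; rewrite gamma1_mxE.
apply: mxsmoothM => //.
exact: (mxsmooth_drinv (fr_free c) (mxsmooth_frame c)
  (dzbarmx_frame c) (dzbarmx_frame_adj c)).
Qed.

Lemma dzbarmx_gamma1C c c' e t u p :
  dzbarmx t (gamma1_mx c c' e u) p = dzbarmx u (gamma1_mx c c' e t) p.
Proof.
have sd v := mxsmooth_drinv (fr_free c) (mxsmooth_frame c)
  (dzbarmx_frame c) (dzbarmx_frame_adj c) v.
rewrite (eq_dzbarmx _ (gamma1_mxE c c' e u)).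
rewrite (eq_dzbarmx _ (gamma1_mxE c c' e t)).
rewrite (dzbarmxMl t _ p (sd u)) (dzbarmxMl u _ p (sd t)); congr (_ *m _).
exact: (dzbarmx_drinvC (fr_free c) (mxsmooth_frame c)
  (dzbarmx_frame c) (dzbarmx_frame_adj c)).
Qed.

Local Notation G := (add_components (@gamma0 R N k) (@gamma1 R N k)).

Lemma G0E c c' : G c c' [::] = gamma0 c c' [::].
Proof. by apply/funext => p; rewrite /add_components /= addr0. Qed.

Lemma G_RL c c' e t : G c c' [:: inr e; inl t] = gamma1_mx c c' e t.
Proof. by apply/funext => p; rewrite /add_components /= add0r. Qed.

Lemma G_LR c c' e t : G c c' [:: inl t; inr e] = fun p => - gamma1_mx c c' e t p.
Proof. by apply/funext => p; rewrite /add_components /= add0r. Qed.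

(** For each list of frame vectors, the types of its entries (true for a
    d/d(zbar_t), false for an e_(a, b)) decide whether the component can be
    nonzero; these are the types for which it can. *)
Definition nonzero_types : seq (seq bool) :=
  [:: [::]; [:: false; true]; [:: true; false]].

Lemma G_eq0 c c' (l : seq (@gen N k)) :
  map (@is_T N k) l \notin nonzero_types -> G c c' l = fun=> 0.
Proof.
case: l => [|[x|x] [|[y|y] [|z l]]] // _; apply/funext => p;
  by rewrite /add_components /= addr0.
Qed.

(** The changes of frame do not mix T_(0,1) and E, so a component contributes
    only to components of the same types. *)
Lemma change_types c c' d d' p q (l' l : seq (@gen N k)) : size l' = size l ->
  \prod_(xy <- zip l' l) change c c' d d' p q xy.1 xy.2 != 0 ->
  map (@is_T N k) l' = map (@is_T N k) l.
Proof.
elim: l' l => [|x l' IHl'] [|y l] //= [/IHl' {}IHl'].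
rewrite big_cons mulf_eq0 negb_or => /andP[xy /IHl' ->]; congr (_ :: _).
by move: xy; case: x => ?; case: y => ? //=; rewrite eqxx.
Qed.

Lemma G_smooth c c' l i j : smooth (fun p => G c c' l p i j).
Proof.
have [/G_eq0 ->|] := boolP (map (@is_T N k) l \notin nonzero_types).
  exact: mxsmooth_cst.
rewrite negbK; case: l => [|[x|x] [|[y|y] [|z l]]] // _.
- rewrite G0E; have -> : gamma0 c c' [::] = _ := funext (gamma0E c c').
  apply: mxsmoothM => //.
  exact: (mxsmooth_rinv (fr_free c) (mxsmooth_frame c)).
- by rewrite G_LR; apply: mxsmoothN; exact: mxsmooth_gamma1_mx.
- by rewrite G_RL; exact: mxsmooth_gamma1_mx.
Qed.

Lemma G_alternating : alternating G.
Proof.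
move=> c c' l1 x y l2 p.
case: l1 => [|a [|b l1]] /=.
- case: l2 => [|z l2]; last by rewrite !G_eq0 ?oppr0 //; case: x; case: y; case: z.
  case: x => x; case: y => y /=.
  + by rewrite !G_eq0 ?oppr0.
  + by rewrite G_LR G_RL.
  + by rewrite G_LR G_RL opprK.
  + by rewrite !G_eq0 ?oppr0.
- by rewrite !G_eq0 ?oppr0 //; case: a; case: x; case: y.
- by rewrite !G_eq0 ?oppr0 //; case: a; case: b; case: l1.
Qed.

Lemma G_bidegree : bidegree_diff 0 G.
Proof.
move=> c c' l p Gl.
have : map (@is_T N k) l \in nonzero_types.
  by apply: contraNT Gl => /G_eq0 ->.
by case: l {Gl} => [|[x|x] [|[y|y] [|z l]]].
Qed.

Lemma G_compatible : compatible G.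
Proof.
move=> c c' d d' p q pq l.
have [nl|] := boolP (map (@is_T N k) l \notin nonzero_types).
  rewrite (G_eq0 d d' nl) mul0mx big1 ?mulmx0 // => l' _.
  have [->|nz] := eqVneq (\prod_(xy <- zip l' l) change c c' d d' p q xy.1 xy.2) 0.
    by rewrite scale0r.
  have tl := change_types (size_tuple l') nz.
  by rewrite G_eq0 ?scaler0 ?tl.
rewrite negbK; case: l => [|[x|x] [|[y|y] [|z l]]] // _.
- rewrite (sum_tuple0 (fun l' => (\prod_(xy <- zip l' [::])
     change c c' d d' p q xy.1 xy.2) *: G c c' l' p)).
  rewrite big_nil scale1r !G0E !gamma0E.
  case: pq => /pt_transition[T uT hT] /pt_transition[T' uT' hT'].
  rewrite hT hT' !Hcoord_frame rinv_mull ?frame_free //.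
  by rewrite -!mulmxA mulVmx // mulmx1.
- rewrite (sum_tuple2 (fun l' => (\prod_(xy <- zip l' [:: inl x; inr y])
     change c c' d d' p q xy.1 xy.2) *: G c c' l' p)).
  rewrite G_LR mulNmx (gamma1_change _ _ pq) -mulmxN; congr (_ *m _).
  rewrite [RHS]exchange_big -sumrN [RHS]big_sumType /=; apply/esym.
  rewrite big1 ?add0r => [|t _]; last first.
    apply: big1 => y' _.
    by rewrite 2!big_cons big_nil /= mul0r mulr0 scale0r.
  apply: eq_bigr => a _; rewrite big_sumType /= addrC big1 ?add0r => [|e _]; last first.
    by rewrite 2!big_cons big_nil /= mul0r scale0r.
  rewrite -sumrN; apply: eq_bigr => t _.
  by rewrite 2!big_cons big_nil G_LR mulr1 scalerN mulrC.
- rewrite (sum_tuple2 (fun l' => (\prod_(xy <- zip l' [:: inr x; inl y])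
     change c c' d d' p q xy.1 xy.2) *: G c c' l' p)).
  rewrite G_RL (gamma1_change _ _ pq); congr (_ *m _).
  rewrite [RHS]big_sumType /=; apply/esym.
  rewrite big1 ?add0r => [|t _]; last first.
    apply: big1 => y' _.
    by rewrite 2!big_cons big_nil /= mul0r scale0r.
  apply: eq_bigr => a _; rewrite big_sumType /= addrC big1 ?add0r => [|e _]; last first.
    by rewrite 2!big_cons big_nil /= mul0r mulr0 scale0r.
  apply: eq_bigr => t _.
  by rewrite 2!big_cons big_nil G_RL mulr1.
Qed.

(** Lists of length 1 give delta_eta gamma_1 = dbar gamma_0 and lists of length 3
    give dbar gamma_1 = 0; for the other lengths each term vanishes. *)
Lemma G_nabla c c' l p : nabla_eta G c c' l p = 0.
Proof.
rewrite /nabla_eta /delta_eta /dbar.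
have dG0 t (l0 : seq (@gen N k)) : map (@is_T N k) l0 \notin nonzero_types ->
  dzbarmx t (G c c' l0) p = 0 by move=> /G_eq0 ->; exact: dzbarmx_cst.
have dGLR t u e : dzbarmx u (G c c' [:: inl t; inr e]) p =
    - dzbarmx u (gamma1_mx c c' e t) p.
  rewrite G_LR (eq_dzbarmx _ (G := fun q => 0 - gamma1_mx c c' e t q)).
    by rewrite dzbarmxCB //; exact: mxsmooth_gamma1_mx.
  by move=> q; rewrite sub0r.
case: l => [|x [|y [|z l]]].
- by rewrite big_ord0 subr0 big1 // => e _; rewrite G_eq0 ?scaler0.
- rewrite big_ord1 expr0 scale1r; case: x => [t|e] /=.
    rewrite G0E dzbarmx_gamma0; under eq_bigr do rewrite G_RL.
    by rewrite sum_eta_gamma1 subrr.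
  by rewrite subr0 big1 // => e' _; rewrite G_eq0 ?scaler0.
- rewrite [X in X - _]big1 => [|e _]; last by rewrite G_eq0 ?scaler0 //; case: x.
  rewrite 2!big_ord_recl big_ord0 /= sub0r.
  have z1 t (w : @gen N k) : dzbarmx t (G c c' [:: w]) p = 0.
    by apply: dG0; case: w.
  by case: x; case: y => * /=; rewrite ?z1 ?scaler0 ?addr0 ?oppr0.
- rewrite [X in X - _]big1 => [|e _]; last first.
    by rewrite G_eq0 ?scaler0 //; case: x; case: y.
  rewrite sub0r; apply/eqP; rewrite oppr_eq0; apply/eqP.
  case: l => [|w l].
    rewrite 3!big_ord_recl big_ord0 /= /bump /= !expr0 expr1 sqrrN expr1n.
    rewrite scale1r addr0.
    case: x => [t|e]; case: y => [u|e']; case: z => [v|e''] /=;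
      rewrite ?dGLR ?G_RL ?dG0 // ?scaler0 ?addr0 ?add0r ?scale1r ?scaleN1r
              ?opprK //.
    + by rewrite dzbarmx_gamma1C addNr.
    + by rewrite dzbarmx_gamma1C subrr.
    + by rewrite dzbarmx_gamma1C addNr.
  apply: big1 => r _.
  have rl : (2 < size (take r [:: x, y, z, w & l] ++
                       drop r.+1 [:: x, y, z, w & l]))%N.
    rewrite size_cat size_take size_drop (ltn_ord r) /= subSS subnKC //.
    by rewrite -ltnS ltn_ord.
  case: onth => [[t|e]|]; rewrite ?scaler0 // dG0 ?scaler0 //.
  move: (_ ++ _) rl => [|a [|b [|c0 l0]]] // _.
  by case: a; case: b.
Qed.

Lemma G_diagonal c c' p : pt c (zco p) = pt c' (wco p) ->
  G c c' [::] p *m frame c (zco p) = frame c' (wco p).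
Proof.
move=> /pt_transition[T uT hT]; rewrite G0E gamma0E hT.
by rewrite -!mulmxA [frame c _ *m _]mulmxA mulmx_rinv ?frame_free // mul1mx.
Qed.

End Weight.

Theorem proposition13 (R : realType) (N k : nat)
    (hk1 : (1 <= k)%N) (hk2 : (k <= N - 1)%N) :
  is_weight (add_components (@gamma0 R N k) (@gamma1 R N k)).
Proof.
have kN : (k <= N)%N := leq_trans hk2 (leq_subr 1 N).
split; [split|exact: G_nabla|exact: G_diagonal].
- exact: G_smooth.
- exact: G_alternating.
- exact: G_bidegree.
- exact: G_compatible.
Qed.
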